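(* Let $\mathcal{G} = (\mathcal{V},\mathcal{E})$ be a simple directed graph, let $i \in \mathcal{V}$ and $\mathcal{C} \subseteq \mathcal{V}$. Let $\mathcal{D}(\mathcal{C})$ be any derived vertex set of $\mathcal{C}$ with respect to $\mathcal{N}^+_i$ (obtained from $\mathcal{G}$ and $\mathcal{C}$ by the graph simplification process). Then $(i,\mathcal{N}^+_i)$ is identifiable from $\mathcal{C}$ in $\mathcal{G}$ if and only if $\mathcal{N}^+_i \subseteq \mathcal{D}(\mathcal{C})$.
   Context: Graphs: $\mathcal{G}=(\mathcal{V},\mathcal{E})$ is a finite directed graph with vertex set $\mathcal{V}=\{1,\dots,n\}$ and edge set $\mathcal{E}\subseteq\mathcal{V}\times\mathcal{V}$; it is simple, i.e. without self-loops and with at most one edge from one node to another. For an edge $(i,j)$, which is an outgoing edge of $i$, $j$ is an out-neighbour of $i$ and $i$ is an in-neighbour of $j$. $\mathcal{N}_i^+$ and $\mathcal{N}_i^-$ are the sets of out-neighbours and in-neighbours of $i$. A path is a set of edges $\{(v_i,v_{i+1}) : i=1,\dots,k\}\subseteq\mathcal{E}$ with $v_1,\dots,v_{k+1}$ distinct; it has starting node $v_1$ and end node $v_{k+1}$. A node $j$ is reachable from $\mathcal{U}\subseteq\mathcal{V}$ if $j\in\mathcal{U}$ (by convention) or there is a path from some node of $\mathcal{U}$ to $j$. Admissible network matrices: $\mathcal{A}(\mathcal{G})$ is the set of all $n\times n$ matrices $G(z)$ such that (P1) every entry $G_{ij}(z)$ is a proper rational function of $z$ with real coefficients (degree of numerator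 at most degree of denominator); (P2) $G_{ij}(z)$ is nonzero if and only if $(j,i)\in\mathcal{E}$; (P3) every principal minor of $\lim_{z\to\infty}(I-G(z))$ is nonzero. For $G\in\mathcal{A}(\mathcal{G})$, $T(z;G):=(I-G(z))^{-1}$. Identifiability: for $\mathcal{C}=\{v_1,\dots,v_p\}\subseteq\mathcal{V}$ let $C$ be the $p\times n$ matrix with $C_{ij}=1$ if $j=v_i$ and $C_{ij}=0$ otherwise. $(i,\mathcal{N}_i^+)$ is (globally) identifiable from $\mathcal{C}$ if for all $G(z),\bar G(z)\in\mathcal{A}(\mathcal{G})$: $C\,T(z;G)=C\,T(z;\bar G)$ implies $G_{\bullet i}(z)=\bar G_{\bullet i}(z)$, where $G_{\bullet i}$ is the $i$-th column of $G$. Graph simplification process (for given $\mathcal{G}$ and $\mathcal{U},\mathcal{W}\subseteq\mathcal{V}$): consider the following two operations on the current graph and the current set $\mathcal{W}$. (1) Remove all outgoing edges of nodes in $\mathcal{W}$ from the graph. (2) If some $k\in\mathcal{W}\setminus\mathcal{U}$ has exactly one in-neighbour $j\in\mathcal{N}_k^-$ that is reachable from $\mathcal{U}$ (in-neighbours and reachability taken in the current graph), replace $k$ by $j$ in $\mathcal{W}$, i.e. replace $\mathcal{W}$ by $(\mathcal{W}\setminus\{k\})\cup\{j\}$. Operations 1 and 2 are applied consecutively, in any order, until no more changes are possible. Any final vertex set obtained this way is called a derived vertex set of $\mathcal{W}$ with respect to $\mathcal{U}$ and denoted $\mathcal{D}(\mathcal{W})$; it need not be unique. Here it is used with $\mathcal{W}=\mathcal{C}$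 and $\mathcal{U}=\mathcal{N}_i^+$, where $\mathcal{N}_i^+$ is taken in the original graph $\mathcal{G}$. *)

(* Defs.v *)
From HB Require Import structures.
From Stdlib Require Export Relation_Operators.
From mathcomp Require Export all_boot all_order all_algebra.
From mathcomp Require Export generic_quotient.
From mathcomp Require Export all_classical all_reals all_analysis.
Export numFieldNormedType.Exports.

Set Implicit Arguments.
Unset Strict Implicit.
Unset Printing Implicit Defensive.

Import Order.TTheory GRing.Theory Num.Theory.

Local Open Scope ring_scope.

(* Edge sets are finite sets, so there is at most one edge from one node to
   another by construction. *)
Definition digraph (n : nat) := {set 'I_n * 'I_n}.

Section Digraph.
Variable n : nat.
Implicit Types (E : digraph n) (U W : {set 'I_n}) (i j k : 'I_n).

Definition simple_digraph E : Prop := forall j, (j, j) \notin E.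

Definition edge E : rel 'I_n := fun j k => (j, k) \in E.

Definition out_nbrs E i : {set 'I_n} := [set j | (i, j) \in E].
Definition in_nbrs E k : {set 'I_n} := [set j | (j, k) \in E].

Definition is_path_from_to E u j (p : seq 'I_n) : Prop :=
  [/\ path (edge E) u p, uniq (u :: p) & last u p = j].

Definition reachable E U j : Prop :=
  j \in U \/ exists u p, u \in U /\ is_path_from_to E u j p.

Definition sole_reachable_in_nbr E U k j : Prop :=
  [/\ j \in in_nbrs E k, reachable E U j &
      forall l, l \in in_nbrs E k -> reachable E U l -> l = j].

(* A state is (current edge set, current vertex set W). *)
Inductive simplification_step U :
    digraph n * {set 'I_n} -> digraph n * {set 'I_n} -> Prop :=
| RemoveOutEdges E W :
    simplification_step U (E, W) (E :\: [set a | a.1 \in W], W)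
| ReplaceNode E W k j :
    k \in W :\: U -> sole_reachable_in_nbr E U k j ->
    simplification_step U (E, W) (E, j |: (W :\ k)).

(* The first operation always applies, so "no more changes are possible" means
   that every applicable operation leaves the state as it is. *)
Definition derived_vertex_set E U W D : Prop :=
  exists E' : digraph n,
    clos_refl_trans _ (simplification_step U) (E, W) (E', D) /\
    forall s, simplification_step U (E', D) s -> s = (E', D).

End Digraph.

Section Network.
Variable R : realType.

Local Open Scope classical_set_scope.

Definition ratfun := {fraction {poly R}}.

(* Degrees compare as sizes do: [size p] is deg p + 1, and 0 for [p = 0]. *)
Definition proper (f : ratfun) : Prop :=
  exists p q : {poly R},
    [/\ q != 0, f = tofrac p / tofrac q & (size p <= size q)%N].

(* [repr f] is some representative of the fraction [f]; two representatives
   have the same value wherever both denominators are nonzero, i.e. at all but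
   finitely many points, so the limit below does not depend on it. *)
Definition ratfun_eval (f : ratfun) (z : R) : R :=
  let: (p, q) := fraction.frac (repr f) in p.[z] / q.[z].

(* For a proper [f] the limit as z tends to infinity exists, is real, and is the
   same along every unbounded direction; it is taken along z --> +oo. *)
Definition lim_at_infinity (f : ratfun) : R := lim (ratfun_eval f z @[z --> +oo]).

Definition lim_mx (m n : nat) (M : 'M[ratfun]_(m, n)) : 'M[R]_(m, n) :=
  map_mx lim_at_infinity M.

Definition principal_minor (n : nat) (M : 'M[R]_n) (S : {set 'I_n}) : R :=
  \det (\matrix_(a < #|S|, b < #|S|) M (enum_val a) (enum_val b)).

Definition admissible (n : nat) (E : digraph n) (G : 'M[ratfun]_n) : Prop :=
  [/\ forall i j, proper (G i j),
      forall i j, G i j != 0 <-> (j, i) \in E &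
      forall S : {set 'I_n}, principal_minor (lim_mx (1%:M - G)) S != 0].

Definition transfer (n : nat) (G : 'M[ratfun]_n) : 'M[ratfun]_n :=
  invmx (1%:M - G).

(* The rows list the elements of [C] in increasing order. *)
Definition selection_mx (n : nat) (C : {set 'I_n}) : 'M[ratfun]_(#|C|, n) :=
  \matrix_(a, j) (j == enum_val a)%:R.

Definition identifiable (n : nat) (E : digraph n) (i : 'I_n) (C : {set 'I_n}) :
    Prop :=
  forall G Gbar : 'M[ratfun]_n, admissible E G -> admissible E Gbar ->
    selection_mx C *m transfer G = selection_mx C *m transfer Gbar ->
    col i G = col i Gbar.

End Network.

(* Main.v *)
Require Import Defs.
From mathcomp Require Import ring.

Set Implicit Arguments.
Unset Strict Implicit.
Unset Printing Implicit Defensive.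
Import Order.TTheory GRing.Theory Num.Theory.
Local Open Scope ring_scope.

(** The vertices of [C] observe the vectors [T v], so equality of the observed
transfer matrices says that [x = T v] vanishes on [C], where [v] is the
difference of the two [i]-th columns. Such a [v] is supported on the
out-neighbours [U] of [i], which means that [x] satisfies the balance equation
[x k = \sum_l G k l * x l] at every vertex [k] outside [U]. Identifiability thus
becomes a question about balanced vectors, and the two operations of the
simplification process are what one can deduce about a balanced vector that
vanishes on the current set: its zero entries make the outgoing edges of their
vertices irrelevant, and if [x k = 0] while a single in-neighbour [j] of [k] can
carry a nonzero value, then [x j = 0].

Suppose that [U] is contained in the derived set. The deductions propagate the
zeros from [C] to the derived set ([run_silent]), hence to [U], and a balanced
vector that vanishes on [U] is zero ([balanced_eq0]). Both this and the fact that
unreachable vertices carry zero ([unreachable_eq0]) come from the nonzero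
principal minors: a vector that solves the homogeneous system of a principal
submatrix of [I - G] vanishes ([principal_system_eq0]). The minors are conditions
on limits, so properness enters here, through a computation of limits at infinity
modulo strictly proper functions.

Conversely, let [u] in [U] lie outside the derived set. In the final graph every
vertex off [U] that must be zero, and that is reached at all, has two reachable
in-neighbours whose contributions can cancel; every other reached vertex has an
in-neighbour nearer to [U]. Hence all reachable vertices outside the derived set
can be given nonzero values by a suitable network ([final_undetected]). This
network and its balanced vector lift back through the operations to the original
graph ([run_undetected]). A nonzero balanced vector [y] that vanishes on [C] then
turns [G] into another network with the same observations, by the rank one update
[I - Gbar = (I - G) (I - y e_i)] ([undetected_not_identifiable]). All networks
built here are strictly proper, so that [I - G] tends to the identity and the
minor condition holds automatically. *)

(** * Limits of rational functions at infinity *)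

Lemma cross_multiply (K : fieldType) (f a p q r s : K) :
  q != 0 -> s != 0 -> f = p / q -> f - a = r / s -> (p - a * q) * s = r * q.
Proof.
move=> q0 s0 -> E.
have -> : p - a * q = (p / q - a) * q by field.
by rewrite E; field.
Qed.

Local Open Scope quotient_scope.
(** Relates the opaque quotient representative used to evaluate a rational
function to the field operations. *)
Lemma fraction_repr (A : idomainType) (f : {fraction A}) :
  f = tofrac (fraction.frac (repr f)).1 / tofrac (fraction.frac (repr f)).2.
Proof.
set x := repr f; have x0 : x.2 != 0 := denom_ratioP _.
apply/eqP; rewrite -(inj_eq (mulIf (_ : tofrac x.2 != 0))) ?tofrac_eq0//.
rewrite divfK ?tofrac_eq0//; apply/eqP.
rewrite -[f in LHS]reprK -/x; unlock FracField.tofrac.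
rewrite -[LHS]FracField.pi_mul /FracField.mulf.
apply/eqmodP; rewrite /= FracField.equivfE !numden_Ratio ?mulr1 ?oner_eq0//.
by rewrite mulrC.
Qed.
Local Close Scope quotient_scope.

Section Limits.
Variable R : realType.
Implicit Types (f g : ratfun R) (a b : R) (p q r : {poly R}).

Local Notation "p %:F" := (tofrac p).
Local Notation "a %:K" := (tofrac a%:P : ratfun R) (at level 2, format "a %:K").

Definition strictly_proper f : Prop :=
  exists p q, [/\ q != 0, f = p%:F / q%:F & (size p < size q)%N].

(** An algebraic form of convergence to [a] at infinity, under which the proper
functions visibly form a ring and the value is a ring morphism. *)
Definition value_at_infinity f a : Prop := strictly_proper (f - a%:K).

(** Fixing the polynomial ring here keeps rewriting with these rules from
unfolding the fraction field while it looks for a product or a sum. *)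
Lemma fracD p q : (p + q)%:F = p%:F + q%:F. Proof. exact: tofracD. Qed.
Lemma fracB p q : (p - q)%:F = p%:F - q%:F. Proof. exact: tofracB. Qed.
Lemma fracN p : (- p)%:F = - p%:F. Proof. exact: tofracN. Qed.
Lemma fracM p q : (p * q)%:F = p%:F * q%:F. Proof. exact: tofracM. Qed.

Lemma strictly_properW f : strictly_proper f -> proper f.
Proof. by case=> p [q [q0 -> /ltnW]]; exists p, q. Qed.

Lemma strictly_proper0 : strictly_proper 0.
Proof.
exists 0, 1; rewrite oner_neq0 tofrac0 mul0r size_poly0 size_poly1.
by split.
Qed.

Lemma strictly_properD f g :
  strictly_proper f -> strictly_proper g -> strictly_proper (f + g).
Proof.
move=> [p [q [q0 -> spq]]] [p' [q' [q'0 -> spq']]].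
exists (p * q' + p' * q), (q * q').
have qF : q%:F != 0 by rewrite tofrac_eq0.
have q'F : q'%:F != 0 by rewrite tofrac_eq0.
split; first by rewrite mulf_neq0.
  by rewrite fracD !fracM (addf_div _ _ qF q'F).
have sq : (0 < size q)%N by rewrite size_poly_gt0.
have sq' : (0 < size q')%N by rewrite size_poly_gt0.
have lt (r s t : {poly R}) : s != 0 -> t != 0 -> (size r < size s)%N ->
    (size (r * t)%R < size (s * t)%R)%N.
  move=> s0 t0; have [-> _|r0 rs] := eqVneq r 0.
    by rewrite mul0r size_poly0 size_poly_gt0 mulf_neq0.
  have st : (0 < size t)%N by rewrite size_poly_gt0.
  have ss : (0 < size s)%N by rewrite size_poly_gt0.
  by rewrite !size_mul// -(prednK st) !addnS/= ltn_add2r.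
rewrite (leq_ltn_trans (size_polyD _ _))// gtn_max lt//=.
by rewrite [q * q']mulrC lt.
Qed.

Lemma proper_strictly_properM f g :
  proper f -> strictly_proper g -> strictly_proper (f * g).
Proof.
move=> [p [q [q0 -> spq]]] [p' [q' [q'0 -> spq']]].
exists (p * p'), (q * q'); split; first by rewrite mulf_neq0.
  by rewrite !fracM invfM mulrACA.
have sq : (0 < size q)%N by rewrite size_poly_gt0.
rewrite (@size_mul _ q q')// (leq_ltn_trans (size_polyMleq _ _))//.
have sq' : (0 < size q')%N by rewrite size_poly_gt0.
rewrite -(prednK sq) addSn/=.
rewrite -(prednK sq) in spq.
have [->|p0] := posnP (size p).
  apply: leq_ltn_trans (_ : (size q').-1 < _)%N.
    by rewrite add0n -!subn1 leq_sub2r// ltnW.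
  by rewrite prednK// leq_addl.
rewrite -(prednK p0) addSn/=; rewrite -(prednK p0) in spq.
by apply: (@leq_trans ((size p).-1 + size q')); rewrite ?ltn_add2l ?leq_add2r.
Qed.

Lemma proper_const a : proper a%:K.
Proof.
exists a%:P, 1; rewrite oner_neq0 tofrac1 divr1 size_poly1 size_polyC.
by split=> //; case: (a != 0).
Qed.

Lemma strictly_properM f g :
  strictly_proper f -> strictly_proper g -> strictly_proper (f * g).
Proof. by move/strictly_properW; exact: proper_strictly_properM. Qed.

Lemma strictly_properN f : strictly_proper f -> strictly_proper (- f).
Proof.
move=> sf; rewrite -mulN1r; apply: proper_strictly_properM => //.
by rewrite -tofrac1 -fracN -polyCN; exact: proper_const.
Qed.

Lemma strictly_properMn f m : strictly_proper f -> strictly_proper (f *+ m).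
Proof.
move=> sf; elim: m => [|m ih]; first exact: strictly_proper0.
by rewrite mulrS; apply: strictly_properD.
Qed.

Lemma strictly_properX f m :
  strictly_proper f -> (0 < m)%N -> strictly_proper (f ^+ m).
Proof.
move=> sf; elim: m => // -[|m] ih _; first by rewrite expr1.
by rewrite exprS; apply: strictly_properM => //; apply: ih.
Qed.

Lemma strictly_proper_sum (I : Type) (s : seq I) (P : pred I)
    (F : I -> ratfun R) :
  (forall l, P l -> strictly_proper (F l)) ->
  strictly_proper (\sum_(l <- s | P l) F l).
Proof.
move=> sF; apply: (big_ind strictly_proper) => //.
  exact: strictly_proper0.
exact: strictly_properD.
Qed.

Lemma strictly_proper_const a : strictly_proper a%:K -> a = 0.
Proof.
move=> [p [q [q0 E spq]]]; apply/eqP/negPn/negP => a0.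
have qF : q%:F != 0 by rewrite tofrac_eq0.
move: spq; have -> : p = a *: q.
  apply/eqP; rewrite -tofrac_eq -mul_polyC fracM E.
  by rewrite mulrAC -mulrA divff// mulr1.
by rewrite size_scale// ltnn.
Qed.

Lemma strictly_proper_neq1 f : strictly_proper f -> 1 + f != 0.
Proof.
move=> sf; apply/eqP => /eqP; rewrite addrC addr_eq0 => /eqP E.
have : strictly_proper (1%:K).
  by rewrite -[_%:K]opprK tofrac1 -E; exact: strictly_properN.
by move/strictly_proper_const/eqP; rewrite oner_eq0.
Qed.

Local Open Scope classical_set_scope.

Lemma eq_near_cvg (u v : R -> R) (l : R) : (\forall z \near +oo, u z = v z) ->
  u z @[z --> +oo] --> l -> v z @[z --> +oo] --> l.
Proof. by move=> uv; apply: cvg_trans; apply: near_eq_cvg. Qed.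

(** By Horner's rule each step divides the earlier terms by [z ^ m] and leaves the
new constant over a positive power of [z], which tends to [0]. *)
Lemma horner_div_exp_cvg p m : (size p <= m.+1)%N ->
  p.[z] / z ^+ m @[z --> +oo] --> p`_m.
Proof.
have zV : (z : R)^-1 @[z --> +oo] --> 0.
  apply/gtr0_cvgV0; last exact: cvg_id.
  exact: nbhs_pinfty_gt.
elim/poly_ind: p m => [|p c ih] m sp.
  rewrite coef0; apply: (@eq_near_cvg (fun=> 0)); last exact: cvg_cst.
  by near=> z; rewrite horner0 mul0r.
case: m sp => [|m] sp.
  rewrite (size1_polyC sp) coefC/=; set a := _`_0.
  apply: (@eq_near_cvg (fun=> a)); last exact: cvg_cst.
  by near=> z; rewrite hornerC expr0 divr1.
rewrite coefD coefMX coefC/= addr0.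
have sp' : (size p <= m.+1)%N.
  have [->|p0] := eqVneq p 0; first by rewrite size_poly0.
  move: sp; rewrite size_MXaddC (negPf p0)/=; exact.
have c0 : c * (z ^-1 ^+ m.+1) @[z --> +oo] --> (c * 0 ^+ m.+1 : R).
  apply: cvgM; first exact: cvg_cst.
  exact: (continuous_cvg _ (@exprn_continuous _ _ _) zV).
rewrite expr0n mulr0 in c0.
rewrite -[p`_m]addr0; apply: (eq_near_cvg _ (cvgD (ih _ sp') c0)).
near=> z.
have z0 : z != 0 by apply: lt0r_neq0; near: z; exact: nbhs_pinfty_gt.
change (p.[z] / z ^+ m + c * z^-1 ^+ m.+1 = (p * 'X + c%:P).[z] / z ^+ m.+1).
rewrite hornerMXaddC exprVn exprS; field.
by rewrite z0 expf_neq0.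
Unshelve. all: by end_near. Qed.

(** The limit of a rational function can be read off any congruence modulo the
strictly proper ones: write its chosen representative as a constant plus a
remainder of lower degree, and divide by the leading power of [z]. *)
Lemma lim_at_infinityE f a : value_at_infinity f a -> lim_at_infinity f = a.
Proof.
move=> [r [s [s0 E srs]]]; rewrite /lim_at_infinity /ratfun_eval.
have Ef := fraction_repr f.
have q0 : (fraction.frac (repr f)).2 != 0 := denom_ratioP _.
move: Ef q0; case: (fraction.frac (repr f)) => p q /= Ef q0.
have qF : q%:F != 0 by rewrite tofrac_eq0.
have sF : s%:F != 0 by rewrite tofrac_eq0.
(* [f = a + t / q], and [t / q = r / s] bounds the degree of [t]. *)
pose t := p - a *: q.
have ts : t * s = r * q.
  apply/eqP; rewrite -tofrac_eq /t -mul_polyC fracM fracB !fracM.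
  by apply/eqP; exact: (cross_multiply qF sF Ef E).
have st : (size t < size q)%N.
  have [->|t0] := eqVneq t 0; first by rewrite size_poly0 size_poly_gt0.
  have r0 : r != 0.
    apply: contraNneq t0 => r0; move/eqP: ts.
    by rewrite r0 mul0r mulf_eq0 (negPf s0) orbF.
  have ss : (0 < size s)%N by rewrite size_poly_gt0.
  move/(congr1 (fun u : {poly R} => size u)): ts; rewrite !size_mul//.
  have rg : (0 < size r)%N by rewrite size_poly_gt0.
  move: srs; move: rg ss.
  case: (size r) => // m _; case: (size s) => // k _.
  rewrite ltnS addnS addSn/= => mk tq.
  by rewrite -(ltn_add2r k) tq addnC ltn_add2l.
apply/cvg_lim => //.
pose m := (size q).-1.
have sq : size q = m.+1 by rewrite prednK// size_poly_gt0.
have qm0 : q`_m != 0 by rewrite -/(lead_coef q) lead_coef_eq0.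
have tm0 : t`_m = 0 by rewrite nth_default// -ltnS -sq.
have tc : t.[z] / z ^+ m @[z --> +oo] --> t`_m.
  by apply: horner_div_exp_cvg; rewrite -sq ltnW.
have qc : q.[z] / z ^+ m @[z --> +oo] --> q`_m.
  by apply: horner_div_exp_cvg; rewrite sq.
have cvg_quot := cvgD (cvg_cst a) (cvgM tc (cvgV qm0 qc)).
rewrite tm0 mul0r addr0 in cvg_quot.
apply: (@eq_near_cvg (fun z => a + t.[z] / z ^+ m * (q.[z] / z ^+ m)^-1));
  last exact: cvg_quot.
have qn : \forall z \near +oo, q.[z] / z ^+ m != 0 by exact: cvgr_neq0 qc qm0.
near=> z.
have : q.[z] / z ^+ m != 0 by near: z.
rewrite mulf_eq0 negb_or invr_eq0 => /andP[qz zm].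
rewrite /t !hornerE; field.
by rewrite qz zm.
Unshelve. all: by end_near. Qed.

Local Close Scope classical_set_scope.

Lemma value_const a : value_at_infinity a%:K a.
Proof. by rewrite /value_at_infinity subrr; exact: strictly_proper0. Qed.

Lemma value_proper f a : value_at_infinity f a -> proper f.
Proof.
move=> [p [q [q0 E spq]]].
exists (p + a *: q), q; split=> //.
  rewrite fracD -mul_polyC fracM mulrDl mulfK ?tofrac_eq0//.
  by rewrite -E subrK.
rewrite (leq_trans (size_polyD _ _))// geq_max (ltnW spq)/=.
exact: size_scale_leq.
Qed.

Lemma proper_value f : proper f -> value_at_infinity f (lim_at_infinity f).
Proof.
move=> [p [q [q0 E spq]]].
suff [a fa] : exists a, value_at_infinity f a by rewrite (lim_at_infinityE fa).
have lq : lead_coef q != 0 by rewrite lead_coef_eq0.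
exists (p`_(size q).-1 / lead_coef q); set a := _ / _.
have qF : q%:F != 0 by rewrite tofrac_eq0.
exists (p - a *: q), q; split=> //.
  by rewrite fracB -mul_polyC fracM mulrBl mulfK// E.
have sq : size q = (size q).-1.+1 by rewrite prednK// size_poly_gt0.
rewrite [X in (_ < X)%N]sq ltnS; apply/leq_sizeP => j.
rewrite leq_eqVlt => /orP[/eqP <-|lj]; rewrite coefB coefZ.
  by rewrite /a divfK// subrr.
rewrite !nth_default ?mulr0 ?subrr//; first by rewrite sq.
by rewrite (leq_trans spq)// sq.
Qed.

Lemma value0 a : value_at_infinity 0 a -> a = 0.
Proof.
rewrite /value_at_infinity sub0r => /strictly_properN.
by rewrite opprK => /strictly_proper_const.
Qed.

Lemma valueD f g a b : value_at_infinity f a -> value_at_infinity g b ->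
  value_at_infinity (f + g) (a + b).
Proof.
move=> fa gb; rewrite /value_at_infinity polyCD fracD opprD addrACA.
exact: strictly_properD.
Qed.

Lemma valueN f a : value_at_infinity f a -> value_at_infinity (- f) (- a).
Proof.
move=> fa; rewrite /value_at_infinity polyCN fracN -opprD.
exact: strictly_properN.
Qed.

Lemma valueM f g a b : value_at_infinity f a -> value_at_infinity g b ->
  value_at_infinity (f * g) (a * b).
Proof.
move=> fa gb; rewrite /value_at_infinity polyCM fracM.
have -> : f * g - a%:K * b%:K = f * (g - b%:K) + b%:K * (f - a%:K).
  by rewrite !mulrBr [b%:K * f]mulrC [b%:K * _]mulrC addrA subrK.
apply: strictly_properD; apply: proper_strictly_properM => //.
  exact: value_proper fa.
exact: proper_const.
Qed.

Lemma proper1 : proper (1 : ratfun R).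
Proof. by rewrite -tofrac1; exact: proper_const. Qed.

Lemma properM f g : proper f -> proper g -> proper (f * g).
Proof.
by move=> /proper_value fa /proper_value gb; exact: value_proper (valueM fa gb).
Qed.

Lemma value_det m (M : 'M[ratfun R]_m) (A : 'M[R]_m) :
  (forall i j, value_at_infinity (M i j) (A i j)) ->
  value_at_infinity (\det M) (\det A).
Proof.
move=> MA; rewrite /determinant.
apply: (big_ind2 value_at_infinity); first exact: value_const.
  by move=> *; apply: valueD.
move=> s _; apply: valueM.
  have -> : (-1) ^+ perm.odd_perm s = ((-1) ^+ perm.odd_perm s : R)%:K.
    by case: (perm.odd_perm s); rewrite ?expr1 ?expr0 ?polyCN ?fracN tofrac1.
  exact: value_const.
apply: (big_ind2 value_at_infinity) => //; last by move=> *; apply: valueM.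
by rewrite -tofrac1; exact: value_const.
Qed.

(** The determinant of the principal submatrix of [I - G] on [S] has the minor at
infinity as its value, so it is a nonzero rational function and the submatrix is
invertible. *)
Lemma principal_system_eq0 n (E : digraph n) (G : 'M[ratfun R]_n)
    (S : {set 'I_n}) (x : 'I_n -> ratfun R) :
  admissible E G ->
  (forall k, k \in S -> x k = \sum_(l in S) G k l * x l) ->
  forall k, k \in S -> x k = 0.
Proof.
move=> [properG _ /(_ S) minorS] xS.
pose M := \matrix_(a < #|S|, b < #|S|) (1%:M - G) (enum_val a) (enum_val b).
have Mu : M \in unitmx.
  rewrite unitmxE unitfE; apply: contraNneq minorS => M0; apply/eqP.
  apply: value0; rewrite -M0.
  apply: value_det => a b; rewrite !mxE; apply: proper_value.
  apply: value_proper; apply: valueD.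
    have -> : ((enum_val a == enum_val b)%:R : ratfun R) =
      ((enum_val a == enum_val b)%:R : R)%:K.
      by case: (_ == _); rewrite ?tofrac1 ?tofrac0.
    exact: value_const.
  by apply: valueN; apply: proper_value.
have My : M *m (\col_a x (enum_val a)) = 0.
  apply/colP => a; rewrite mxE [RHS]mxE.
  under eq_bigr do rewrite !mxE mulrBl.
  rewrite sumrB; apply/eqP; rewrite subr_eq0; apply/eqP.
  have -> : \sum_(b < #|S|) G (enum_val a) (enum_val b) * x (enum_val b) =
      \sum_(l in S) G (enum_val a) l * x l by rewrite [RHS]big_enum_val.
  rewrite -xS ?enum_valP// (bigD1 a)//= eqxx mul1r big1 ?addr0// => b ba.
  by rewrite (inj_eq enum_val_inj) eq_sym (negPf ba) mul0r.
move=> k kS; have := mulKmx Mu (\col_a x (enum_val a)).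
rewrite My mulmx0 => /colP/(_ (enum_rank_in kS k)).
by rewrite !mxE enum_rankK_in.
Qed.

End Limits.

(** * Propagation of zeros along the simplification process *)

Section Reachability.
Variable n : nat.
Implicit Types (E : digraph n) (U W : {set 'I_n}) (j k : 'I_n).

Lemma reachableP E U j :
  reachable E U j <-> exists2 u, u \in U & connect (edge E) u j.
Proof.
split=> [[jU|[u [p [uU [up _ upj]]]]]|[u uU /connectP[p up ->]]].
- by exists j.
- by exists u => //; apply/connectP; exists p.
- by case/shortenP: up => q uq uniq_q _; right; exists u, q.
Qed.

Lemma reachable_edge E U j k :
  reachable E U j -> (j, k) \in E -> reachable E U k.
Proof.
move=> /reachableP[u uU uj] jk; apply/reachableP; exists u => //.
exact: connect_trans uj (connect1 _).
Qed.

End Reachability.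

Section Network.
Variables (R : realType) (n : nat).
Implicit Types (E : digraph n) (U W C D : {set 'I_n}) (i j k l : 'I_n).
Implicit Types (G : 'M[ratfun R]_n) (x : 'I_n -> ratfun R).

(** The entries of [(I - G) x] outside [U] are zero: [x] is the response of
the network to some input at [U]. *)
Definition balanced_off U G x : Prop :=
  forall k, k \notin U -> x k = \sum_l G k l * x l.

Definition vanishes_on W x : Prop := forall w, w \in W -> x w = 0.

(** What the simplification process certifies about a balanced vector: the second
clause records that a deleted edge carried no signal. *)
Definition silent_state E x (s : digraph n * {set 'I_n}) : Prop :=
  [/\ s.1 \subset E,
      forall j k, (j, k) \in E -> (j, k) \notin s.1 -> x j = 0 &
      vanishes_on s.2 x].

Lemma admissible_edge E G j k : admissible E G -> (G k j != 0) = ((j, k) \in E).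
Proof. by case=> _ suppG _; apply/idP/idP => /suppG. Qed.

(** On the set of unreachable vertices where [x] is nonzero, all nonzero
contributions come from the set itself: an edge whose source carries a nonzero
value is still in the current graph, so it cannot lead from a reachable vertex to
an unreachable one. Hence [x] solves the homogeneous system of a principal
submatrix of [I - G]. *)
Lemma unreachable_eq0 E U G x s :
  admissible E G -> balanced_off U G x -> silent_state E x s ->
  forall l, ~ reachable s.1 U l -> x l = 0.
Proof.
move=> admG Ux [_ xE _] l nl; have [//|xl] := eqVneq (x l) 0.
pose S := [set k | ~~ `[< reachable s.1 U k >] & x k != 0].
apply: (principal_system_eq0 (S := S) admG); last first.
  by rewrite inE xl andbT; apply/asboolP.
move=> k; rewrite inE => /andP[/asboolP nk xk].
rewrite Ux; last by apply: contra_notN nk => kU; left.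
rewrite (bigID (mem S))/= [X in _ + X]big1 ?addr0// => j.
rewrite inE negb_and !negbK => /orP[/asboolP rj|/eqP->]; last exact: mulr0.
have [->|Gkj] := eqVneq (G k j) 0; first by rewrite mul0r.
have /xE jk : (j, k) \in E by rewrite -(admissible_edge _ _ admG).
rewrite jk ?mulr0//; apply: contra_notN nk; exact: reachable_edge.
Qed.

(** In the balance equation at a replaced vertex [k], the left side is zero and
every contribution but that of the sole reachable in-neighbour vanishes. *)
Lemma step_silent E U G x s s' :
  admissible E G -> balanced_off U G x -> simplification_step U s s' ->
  silent_state E x s -> silent_state E x s'.
Proof.
move=> admG Ux step silent; have [/fintype.subsetP E1E xE xW] := silent.
have x0 := unreachable_eq0 admG Ux silent.
case: step E1E xE xW x0 {silent}; move=> E1 W /=.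
  move=> E1E xE xW _; split=> //=.
    by apply/fintype.subsetP => a /setDP[/E1E].
  move=> j k jk; rewrite !inE/= negb_and negbK.
  by case/orP=> [/xW//|]; exact: xE.
move=> k j /setDP[kW kU] [jk _ sole] E1E xE xW x0.
split=> //=; first exact/fintype.subsetP.
move=> w.
rewrite in_setU1 => /orP[/eqP->|/setD1P[_ /xW//]]; rewrite inE in jk.
have [//|xj] := eqVneq (x j) 0.
have Gkj : G k j != 0 by rewrite (admissible_edge _ _ admG) E1E.
move: (Ux _ kU); rewrite (xW k kW) (bigD1 j)//= big1 ?addr0.
  by move/esym/eqP; rewrite mulf_eq0 (negPf Gkj) => /eqP.
move=> l lj; have [->|Gkl] := eqVneq (G k l) 0; first by rewrite mul0r.
have lk : (l, k) \in E by rewrite -(admissible_edge _ _ admG).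
have [rl|/x0->] := pselect (reachable E1 U l); last by rewrite mulr0.
have [lk1|/(xE _ _ lk)->] := boolP ((l, k) \in E1); last by rewrite mulr0.
by move: lj; rewrite (sole l) ?inE ?eqxx.
Qed.

Lemma admissible_unitmx E G : admissible E G -> 1%:M - G \in unitmx.
Proof.
move=> admG; rewrite -unitmx_tr unitmxE unitfE; apply/det0P => -[v v0].
move=> /rowP vG; case/negP: v0; apply/eqP/rowP => k; rewrite [RHS]mxE.
apply: (principal_system_eq0 (S := [set: 'I_n]) admG (x := v 0)) => // l _.
have := vG l; rewrite mxE [RHS]mxE; under eq_bigr do rewrite !mxE mulrBr.
rewrite sumrB => /eqP; rewrite subr_eq0 (bigD1 l)//= eqxx mulr1 big1 ?addr0.
  move/eqP->; rewrite [RHS](eq_bigl xpredT); last by move=> j; rewrite inE.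
  by apply: eq_bigr => j _; rewrite mulrC.
by move=> j jl; rewrite eq_sym (negPf jl) mulr0.
Qed.

Lemma selection_mulE C m (Y : 'M[ratfun R]_(n, m)) a b :
  (selection_mx R C *m Y) a b = Y (enum_val a) b.
Proof.
rewrite mxE (bigD1 (enum_val a))//= big1 => [|j ja]; rewrite mxE.
  by rewrite eqxx mul1r addr0.
by rewrite (negPf ja) mul0r.
Qed.

Lemma selection_mul_eq0 C (y : 'cV[ratfun R]_n) :
  selection_mx R C *m y = 0 <-> vanishes_on C (y ^~ 0).
Proof.
split=> [/colP Cy w wC|yC].
  have := Cy (enum_rank_in wC w).
  by rewrite selection_mulE enum_rankK_in// mxE.
by apply/colP => a; rewrite selection_mulE mxE yC// enum_valP.
Qed.

Lemma sub_mulE G (y : 'cV[ratfun R]_n) k :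
  ((1%:M - G) *m y) k 0 = y k 0 - \sum_l G k l * y l 0.
Proof. by rewrite mulmxBl mul1mx mxE [X in _ + X]mxE mxE. Qed.

End Network.

(** * Sufficiency *)

Lemma mul_invmx_sub_eq0 (K : fieldType) m n (S : 'M[K]_(m,n)) (A B : 'M[K]_n) :
  A \in unitmx -> B \in unitmx -> S *m invmx A = S *m invmx B ->
  S *m invmx A *m (B - A) = 0.
Proof.
by move=> uA uB SAB; rewrite mulmxBr {1}SAB -!mulmxA !mulVmx// subrr.
Qed.

Section Sufficiency.
Variables (R : realType) (n : nat).
Implicit Types (E : digraph n) (U W C D : {set 'I_n}) (i j k l : 'I_n).
Implicit Types (G : 'M[ratfun R]_n) (x : 'I_n -> ratfun R).

Lemma run_silent E U G x s s' :
  admissible E G -> balanced_off U G x ->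
  clos_refl_trans _ (simplification_step U) s s' ->
  silent_state E x s -> silent_state E x s'.
Proof.
move=> admG Ux; elim=> {s s'} [s s'|//|s t u _ st _ tu /st/tu//].
exact: step_silent admG Ux.
Qed.

(** A balanced vector is determined by its values on [U], because the block of
[I - G] outside [U] is invertible. *)
Lemma balanced_eq0 E U G x :
  admissible E G -> balanced_off U G x -> vanishes_on U x ->
  forall k, x k = 0.
Proof.
move=> admG Ux xU k; have [/xU//|kU] := boolP (k \in U).
apply: (principal_system_eq0 (S := ~: U) admG); last by rewrite inE.
move=> l; rewrite inE => lU; rewrite (Ux _ lU) (bigID (mem (~: U)))/=.
rewrite [X in _ + X]big1 ?addr0// => j; rewrite inE negbK => /xU->.
exact: mulr0.
Qed.

Lemma subset_identifiable E E' C D i :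
  clos_refl_trans _ (simplification_step (out_nbrs E i)) (E, C) (E', D) ->
  out_nbrs E i \subset D -> identifiable R E i C.
Proof.
set U := out_nbrs E i => run /fintype.subsetP UD G Gbar admG admGbar CT.
pose v := col i (G - Gbar).
suff v0 : v = 0.
  by apply/eqP; rewrite -subr_eq0 -raddfB; apply/eqP.
have uG := admissible_unitmx admG; have uGbar := admissible_unitmx admGbar.
pose y := transfer G *m v.
have yv : (1%:M - G) *m y = v := mulKVmx uG v.
have Cy : selection_mx R C *m y = 0.
  have E1 : G - Gbar = (1%:M - Gbar) - (1%:M - G).
    by rewrite opprB [RHS]addrC addrA subrK.
  have SG := mul_invmx_sub_eq0 uG uGbar CT.
  rewrite -E1 in SG.
  by rewrite /y /v colE 2!mulmxA SG mul0mx.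
clearbody y; pose x k := y k 0.
have Ux : balanced_off U G x.
  move=> k; rewrite inE => ikE; apply/eqP; rewrite -subr_eq0.
  rewrite /x -sub_mulE yv !mxE.
  have /negbFE/eqP-> : (G k i != 0) = false.
    by rewrite (admissible_edge _ _ admG) (negPf ikE).
  have /negbFE/eqP-> : (Gbar k i != 0) = false.
    by rewrite (admissible_edge _ _ admGbar) (negPf ikE).
  by rewrite subrr.
have silentC : silent_state E x (E, C).
  split; [by []|by move=> j k /= ->|].
  by move/selection_mul_eq0: Cy.
have [_ _ /= xD] := run_silent admG Ux run silentC.
have x0 := balanced_eq0 admG Ux (fun k kU => xD k (UD k kU)).
have y0 : y = 0 by apply/colP => k; rewrite [RHS]mxE; exact: (x0 k).
by rewrite -yv y0 mulmx0.
Qed.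

End Sufficiency.

(** * Necessity *)

Section Necessity.
Variables (R : realType) (n : nat).
Implicit Types (E : digraph n) (U W C D : {set 'I_n}) (i j k l : 'I_n).
Implicit Types (G : 'M[ratfun R]_n) (x : 'I_n -> ratfun R).

(** Multiplication by [1 / z] is the one-step delay; its powers supply all the
weights below. *)
Definition delay : ratfun R := (tofrac 'X)^-1.

Lemma delay_neq0 : delay != 0.
Proof. by rewrite invr_eq0 tofrac_eq0 polyX_eq0. Qed.

Lemma delay_strictly_proper : strictly_proper delay.
Proof.
by exists 1, 'X; rewrite polyX_eq0 size_polyX size_poly1 tofrac1 div1r.
Qed.

Definition strictly_proper_network E G : Prop :=
  (forall k l, strictly_proper (G k l)) /\
  (forall k l, (G k l != 0) = ((l, k) \in E)).

(** All entries tend to zero, so every principal minor of the limit of [I - G] is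
the determinant of an identity matrix. *)
Lemma strictly_proper_admissible E G :
  strictly_proper_network E G -> admissible E G.
Proof.
move=> [spG suppG]; split=> [k l|k l|S]; first exact: strictly_properW.
  by rewrite suppG.
rewrite /principal_minor (_ : \matrix_(a, b) _ = 1%:M) ?det1 ?oner_eq0//.
apply/matrixP => a b; rewrite !mxE -(inj_eq enum_val_inj).
apply: lim_at_infinityE; rewrite /value_at_infinity.
have -> : ((enum_val a == enum_val b)%:R : ratfun R) =
  tofrac ((enum_val a == enum_val b)%:R : R)%:P.
  by case: (_ == _); rewrite ?tofrac1 ?tofrac0.
by rewrite addrAC subrr add0r; exact: strictly_properN.
Qed.

(** Some network on [E] has a nonzero signal entering at [U] that stays invisible
at [W]. Strict properness is kept for both the network and the signal so that they
can later be combined into another admissible network. *)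
Definition undetected E U W : Prop :=
  exists G x, strictly_proper_network E G /\
    [/\ forall k, strictly_proper (x k), exists k, x k != 0,
        balanced_off U G x & vanishes_on W x].

(** Restored edges leave vertices where [x] is zero, so any nonzero weight may be
put on them. A replaced vertex gets [x k = 0], since its sole reachable
in-neighbour is zero and the unreachable ones always are. *)
Lemma step_undetected U s s' : simplification_step U s s' ->
  undetected s'.1 U s'.2 -> undetected s.1 U s.2.
Proof.
case=> [E W|E W k j /setDP[kW kU] [jk _ sole]] /=;
  move=> [G [x [[spG suppG] [spx x0 Ux xW]]]].
  exists (\matrix_(k, l) if (l \in W) && ((l, k) \in E) then delay else G k l).
  exists x; do 2 split=> //.
  - move=> k l; rewrite mxE; case: ifP => // _; exact: delay_strictly_proper.
  - move=> k l; rewrite mxE; case: ifP => [/andP[_ ->]|]; first exact: delay_neq0.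
    by rewrite suppG !inE/=; case: (l \in W) => //= ->.
  - move=> k kU; rewrite Ux//; apply: eq_bigr => l _; rewrite mxE.
    by case: ifP => // /andP[/xW->]; rewrite !mulr0.
exists G, x; split; first by split.
split=> // w wW.
have [->|wk] := eqVneq w k; last by apply: xW; rewrite !inE wk wW orbT.
rewrite (Ux _ kU) big1// => l _.
have [->|Gkl] := eqVneq (G k l) 0; first by rewrite mul0r.
rewrite suppG in Gkl.
have [rl|nl] := pselect (reachable E U l).
  by rewrite xW ?mulr0// (sole l) ?inE ?eqxx.
have admG := strictly_proper_admissible (conj spG suppG).
have silent0 : silent_state E x (E, finset.set0).
  split=> //= [a b ->//|w' ]; by rewrite inE.
by rewrite (unreachable_eq0 admG Ux silent0 nl) mulr0.
Qed.

Lemma run_undetected U s s' : clos_refl_trans _ (simplification_step U) s s' ->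
  undetected s'.1 U s'.2 -> undetected s.1 U s.2.
Proof.
elim=> {s s'} [s s'|//|s t u _ st _ tu /tu/st//]; exact: step_undetected.
Qed.

(** Here [d] is the length of a shortest walk from [U], and [parent k] is the last
vertex but one of such a walk. *)
Lemma nearer_in_nbr E U : exists (d : 'I_n -> nat) (parent : 'I_n -> 'I_n),
  forall k, reachable E U k -> k \notin U ->
    [/\ reachable E U (parent k), (parent k, k) \in E & (d (parent k) < d k)%N].
Proof.
pose walk k t := `[< exists2 u, u \in U &
  exists2 p, path (edge E) u p & last u p = k /\ size p = t >].
have walk_min k : exists m, reachable E U k ->
    walk k m /\ forall t, walk k t -> (m <= t)%N.
  have [rk|] := pselect (reachable E U k); last by exists 0%N.
  have ex : exists t, walk k t.
    have /reachableP[u uU /connectP[p up ->]] := rk.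
    by exists (size p); apply/asboolP; exists u => //; exists p.
  by exists (ex_minn ex); case: ex_minnP.
have [d dP] := choice walk_min.
have near k : exists j, reachable E U k -> k \notin U ->
    [/\ reachable E U j, (j, k) \in E & (d j < d k)%N].
  have [rk|] := pselect (reachable E U k); last by exists k.
  have [kU|kU] := boolP (k \in U); first by exists k.
  have [/asboolP[u uU [p up [upk pd]]] _] := dP k rk.
  case/lastP: p => [|p l] in up upk pd *; first by rewrite -upk/= uU in kU.
  rewrite last_rcons in upk; rewrite {l}upk in up pd *.
  rewrite rcons_path in up; case/andP: up => up pk.
  have rj : reachable E U (last u p).
    by apply/reachableP; exists u => //; apply/connectP; exists p.
  exists (last u p) => _ _; split=> //.
  rewrite -pd size_rcons ltnS; apply: (dP _ rj).2.
  by apply/asboolP; exists u => //; exists p.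
have [parent parentP] := choice near; by exists d, parent.
Qed.

(** Give every reachable vertex [k] outside [D] the value [w ^ (d k + 1)], where [w]
is the delay and [d] the distance from [U]. At a reachable [k] off [U], let each
reachable in-neighbour other than [parent k] contribute the same small amount
[w ^ (M + 1)], with [M] above all distances, and let the weight of the edge from
[parent k] absorb the rest. As [parent k] is strictly nearer to [U], this weight is
strictly proper. It is nonzero: for [k] outside [D] its leading term is
[w ^ (d k - d (parent k))], and for [k] in [D] it is a nonzero multiple of a power
of [w], because there is at least one other contribution to cancel. *)
Lemma final_undetected E U D u :
  (forall j k, j \in D -> (j, k) \notin E) ->
  (forall k j, k \in D :\: U -> ~ sole_reachable_in_nbr E U k j) ->
  u \in U -> u \notin D -> undetected E U D.
Proof.
move=> outD soleD uU uD; have [d [parent parentP]] := nearer_in_nbr E U.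
pose reach : {set 'I_n} := [set k | `[< reachable E U k >]].
have reachP k : k \in reach -> reachable E U k by rewrite inE => /asboolP.
have reach_edge j k : j \in reach -> (j, k) \in E -> k \in reach.
  by move=> /reachP rj jk; rewrite inE; apply/asboolP; exact: reachable_edge jk.
pose M := (\max_k d k).+1.
have dM k : (d k < M)%N by rewrite ltnS; exact: leq_bigmax.
pose w := delay.
pose x k := if (k \in reach) && (k \notin D) then w ^+ (d k).+1 else 0.
pose others k := [set l in reach | ((l, k) \in E) && (l != parent k)].
pose G : 'M[ratfun R]_n := \matrix_(k, l)
  if (l, k) \notin E then 0
  else if (k \in U) || (l \notin reach) then w
  else if l == parent k then
    (if k \in D then 0 else w ^+ (d k - d l)) - w ^+ (M - d l) *+ #|others k|
  else w ^+ (M - d l).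
have parent_edge k l : (l, k) \in E -> (k \in U) || (l \notin reach) = false ->
    [/\ k \in reach, k \notin U & (d (parent k) < d k)%N].
  move=> lk /negbT; rewrite negb_or negbK => /andP[kU lr].
  have kr := reach_edge _ _ lr lk.
  by have [_ _ dk] := parentP k (reachP k kr) kU.
have w0 m : w ^+ m != 0 by rewrite expf_neq0// delay_neq0.
have spw m : (0 < m)%N -> strictly_proper (w ^+ m).
  exact/strictly_properX/delay_strictly_proper.
exists G, x; split; first split.
- move=> k l; rewrite mxE.
  case: ifP => [_|/negbFE lk]; first exact: strictly_proper0.
  case: ifP => [_|kl]; first exact: delay_strictly_proper.
  have [kr kU dk] := parent_edge _ _ lk kl.
  case: ifP => [/eqP lp|_]; last by apply: spw; rewrite subn_gt0.
  apply: strictly_properD.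
    case: ifP => _; first exact: strictly_proper0.
    by apply: spw; rewrite subn_gt0 lp.
  by apply: strictly_properN; apply: strictly_properMn; apply: spw; rewrite subn_gt0.
- move=> k l; rewrite mxE; case: ifP => [/negPf->|/negbFE lk]; first by rewrite eqxx.
  rewrite lk; case: ifP => [_|kl]; first exact: delay_neq0.
  have [kr kU dk] := parent_edge _ _ lk kl.
  case: ifP => [/eqP lp|_]; last exact: w0.
  rewrite lp; case: ifP => [kD|_].
    rewrite sub0r oppr_eq0 -mulr_natr mulf_neq0 ?w0//.
    rewrite -tofrac1 -tofracMn tofrac_eq0 -polyC1 -polyCMn polyC_eq0 pnatr_eq0.
    (* Without another contribution, [k] could still be replaced. *)
    rewrite cards_eq0; apply/eqP => /setP others0.
    have [pr pk _] := parentP k (reachP k kr) kU.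
    apply: (soleD k (parent k)); first by rewrite inE kU.
    split=> [|//|j]; rewrite inE// => jk rj.
    apply/eqP/negPn/negP => jp.
    by have := others0 j; rewrite !inE jk jp !andbT (introT (asboolP _) rj).
  rewrite (_ : M - d (parent k) = (d k - d (parent k)) + (M - d k))%N.
    rewrite exprD -mulrnAr -[X in X - _]mulr1 -mulrBr mulf_neq0 ?w0//.
    apply: strictly_proper_neq1; apply: strictly_properN; apply: strictly_properMn.
    by apply: spw; rewrite subn_gt0.
  by rewrite addnC addnBA ?subnK// ltnW.
split.
- move=> k; rewrite /x; case: ifP => _; last exact: strictly_proper0.
  exact: spw.
- exists u; rewrite /x uD.
  suff -> : u \in reach by rewrite w0.
  by rewrite inE; apply/asboolP; left.
- move=> k kU; have [kr|kr] := boolP (k \in reach); last first.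
    rewrite /x (negPf kr)/= big1// => l _; rewrite mxE.
    case: ifP => [_|/negbFE lk]; first exact: mul0r.
    have [lr|_] := boolP (l \in reach); last by rewrite mulr0.
    by rewrite (reach_edge l k) in kr.
  have [pr pk dk] := parentP k (reachP k kr) kU.
  have pr' : parent k \in reach by rewrite inE; apply/asboolP.
  have pD : parent k \notin D by apply: contraTN pk => /outD; exact.
  rewrite (bigD1 (parent k))//= (bigID (mem (others k)))/=.
  rewrite [X in _ + (_ + X)]big1 ?addr0; last first.
    move=> l /andP[lp]; rewrite inE lp andbT negb_and => lo.
    rewrite mxE /x; case: ifP => [_|/negbFE lk]; first exact: mul0r.
    by move: lo; rewrite lk orbF => /negPf->; rewrite mulr0.
  rewrite (eq_bigr (fun=> w ^+ M.+1)); last first.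
    move=> l /andP[lp]; rewrite inE lp andbT => /andP[lr lk].
    have lD : l \notin D by apply: contraTN lk => /outD; exact.
    rewrite mxE /x lk lr lD (negPf kU) (negPf lp)/= -exprD addnS subnK//.
    exact: ltnW.
  rewrite (eq_bigl (mem (others k))); last first.
    move=> l /=; rewrite inE; case: (l == parent k) => //=; by rewrite !andbF.
  rewrite sumr_const mxE /x pk pr' pD (negPf kU) eqxx kr /= mulrBl.
  rewrite mulrnAl -exprD addnS subnK ?subrK; last exact: ltnW.
  case: (k \in D) => /=; first by rewrite mul0r.
  by rewrite -exprD addnS subnK// ltnW.
- by move=> k kD; rewrite /x kD andbF.
Qed.

(** The update [Gbar = G + c v e_i], with [v = (I - G) x] supported on the
out-neighbours of [i], factors as [I - Gbar = (I - G) (I - c x e_i)], so the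
transfer matrices agree on the rows where [x] vanishes. Scaling by the product [c]
of the entries of column [i] keeps the support: the new entry at [k] is
[G k i * (1 + f)] with [f] strictly proper, which cannot be zero. *)
Lemma undetected_not_identifiable E i C :
  undetected E (out_nbrs E i) C -> ~ identifiable R E i C.
Proof.
move=> [G [x [netG [spx [k0 xk0] Ux xC]]]] idC; have [spG suppG] := netG.
set U := out_nbrs E i in Ux.
have uG := admissible_unitmx (strictly_proper_admissible netG).
pose c := \prod_(k in U) G k i.
have c0 : c != 0 by apply/prodf_neq0 => k; rewrite inE suppG.
have properP (S : {set 'I_n}) : proper (\prod_(k in S) G k i).
  apply: (big_ind (@proper R)); first exact: proper1.
    exact: properM.
  by move=> k _; exact: strictly_properW.
pose y := c *: (\col_k x k).
pose e : 'rV[ratfun R]_n := delta_mx 0 i.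
pose v := (1%:M - G) *m \col_k x k.
have vE k : v k 0 = x k - \sum_l G k l * x l.
  by rewrite sub_mulE mxE; congr (_ - _); apply: eq_bigr => l _; rewrite mxE.
have spv k : strictly_proper (v k 0).
  rewrite vE; apply: strictly_properD => //; apply: strictly_properN.
  by apply: strictly_proper_sum => l _; exact: strictly_properM.
pose Gbar := G + c *: (v *m e).
have GbarE k l : Gbar k l = G k l + (if l == i then c * v k 0 else 0).
  rewrite mxE [X in _ + X]mxE [(v *m e) k l]mxE big_ord1 [e _ _]mxE eqxx/=.
  by case: (l == i); rewrite ?mulr1 ?mulr0.
have netGbar : strictly_proper_network E Gbar.
  split=> k l; rewrite GbarE.
    apply: strictly_properD => //; case: ifP => _; last exact: strictly_proper0.
    by apply: proper_strictly_properM => //; exact: properP.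
  case: ifP => [/eqP->|_]; last by rewrite addr0.
  have [kU|kU] := boolP (k \in U).
    have ik : (i, k) \in E by rewrite inE in kU.
    have -> : G k i + c * v k 0 =
        G k i * (1 + (\prod_(l in U :\ k) G l i) * v k 0).
      by rewrite mulrDr mulr1 mulrA /c (big_setD1 k kU).
    have Gki : G k i != 0 by rewrite suppG.
    rewrite ik; apply: (mulf_neq0 Gki); apply: strictly_proper_neq1.
    by apply: proper_strictly_properM (spv k); exact: properP.
  by rewrite vE -Ux// subrr mulr0 addr0 suppG.
have uGbar := admissible_unitmx (strictly_proper_admissible netGbar).
have factor : 1%:M - Gbar = (1%:M - G) *m (1%:M - y *m e).
  by rewrite mulmxBr mulmx1 mulmxA -scalemxAr -scalemxAl /Gbar opprD addrA.
have TE : transfer G = (1%:M - y *m e) *m transfer Gbar.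
  rewrite -[RHS](mulKmx uG) [(1%:M - G) *m (_ *m _)]mulmxA -factor.
  by rewrite /transfer (mulmxV uGbar) mulmx1.
have Cy : selection_mx R C *m y = 0.
  by apply/selection_mul_eq0 => k kC; rewrite mxE mxE xC// mulr0.
have CT : selection_mx R C *m transfer G = selection_mx R C *m transfer Gbar.
  by rewrite TE mulmxA mulmxBr mulmx1 mulmxA Cy mul0mx subr0.
have /colP colE := idC _ _ (strictly_proper_admissible netG)
  (strictly_proper_admissible netGbar) CT.
have v0 : v = 0.
  apply/colP => k; rewrite [RHS]mxE; have /eqP := colE k.
  rewrite mxE mxE GbarE eqxx -subr_eq0 opprD addrA subrr sub0r oppr_eq0.
  by rewrite mulf_eq0 (negPf c0) => /eqP.
have := mulKmx uG (\col_k x k); rewrite -/v v0 mulmx0 => /colP/(_ k0).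
by rewrite !mxE => /esym/eqP; rewrite (negPf xk0).
Qed.

End Necessity.

Theorem theorem2 (R : realType) (n : nat) (E : digraph n) (i : 'I_n)
    (C D : {set 'I_n}) (simpleE : simple_digraph E)
    (derivedD : derived_vertex_set E (out_nbrs E i) C D) :
  identifiable R E i C <-> out_nbrs E i \subset D.
Proof.
have [E' [run final]] := derivedD; split; last exact: subset_identifiable run.
move=> idC; apply/fintype.subsetP => u uU; apply: contrapT => /negP uD.
suff : undetected R E (out_nbrs E i) C by move/undetected_not_identifiable.
have outD j k : j \in D -> (j, k) \notin E'.
  move=> jD; have [] := final _ (RemoveOutEdges _ E' D) => /setP/(_ (j, k)).
  by rewrite !inE/= jD => <-.
apply: (run_undetected run) => /=.
apply: (final_undetected R outD _ uU uD) => k j kD sole.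
have [] := final _ (ReplaceNode kD sole) => /setP/(_ k).
have /setDP[kD' _] := kD; case: sole => + _ _.
rewrite inE !inE eqxx kD' orbF => jk /eqP kj.
by move: (outD k k kD'); rewrite {1}kj jk.
Qed.
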